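(* In the standard dyadic grid on $\mathbb R^3$, let $\Omega=[0,1)^3$. For every integer $N\ge0$ there is a finite pairwise incomparable family $\mathcal S_N\subset\mathcal D_{\mathrm{sZ}}$ of rectangles contained in $\Omega$ such that, for every $w\colon\mathbb N^2\to[0,\infty)$, $$\frac1{|\Omega|}\sum_{I\in\mathcal S_N}w(e_1(I;\Omega),e_2(I;\Omega))|I|=\sum_{a,b\ge0,\; a+b\le N}w(a,b).$$ Consequently, any uniform two-depth packing estimate for sub-Zygmund initial families forces $w\in\ell^1(\mathbb N^2)$: if there is a finite constant $C$ such that $\sum_{I\in\mathcal U}w(e_1(I;\Omega'),e_2(I;\Omega'))|I|\le C|\Omega'|$ for every measurable set $\Omega'$ of finite measure and every pairwise incomparable family $\mathcal U\subset\mathcal D_{\mathrm{sZ}}$ of rectangles contained in $\Omega'$, then $\sum_{a,b\ge0}w(a,b)<\infty$.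
   Context: $\mathbb N=\{0,1,2,\dots\}$; $|\cdot|$ is Lebesgue measure. The standard dyadic grid on $\mathbb R$ consists of the intervals $[m2^{-k},(m+1)2^{-k})$, $k,m\in\mathbb Z$; it is used in each of the three coordinates. $\ell(Q)$ is the length of a dyadic interval $Q$, and $Q^{(k)}$ is its $k$th dyadic ancestor (the dyadic interval of length $2^k\ell(Q)$ containing $Q$). The sub-Zygmund basis $\mathcal D_{\mathrm{sZ}}$ consists of all products $I=I^1\times I^2\times I^3$ of dyadic intervals with $\ell(I^3)\le\ell(I^1)\ell(I^2)$. For measurable $\Omega\subset\mathbb R^3$ of finite measure, $\widetilde\Omega:=\{M1_\Omega>1/2\}$ with $Mf(x):=\sup_{R\in\mathcal D_{\mathrm{sZ}},\,x\in R}\frac1{|R|}\int_R|f|$. For $I\in\mathcal D_{\mathrm{sZ}}$ with $I\subset\Omega$ and $i=1,2$, $I_i^{(k)}$ is obtained from $I$ by replacing only $I^i$ by $(I^i)^{(k)}$, and $e_i(I;\Omega):=\max\{k\ge0:I_i^{(k)}\subset\widetilde\Omega\}$. A family is pairwise incomparable if no member is contained in a different member. *)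

(* Defs.v *)
From HB Require Import structures.
From mathcomp Require Import all_boot all_order all_algebra.
From mathcomp Require Import all_classical all_reals all_analysis.
From mathcomp Require Import zify ring lra.

Set Implicit Arguments.
Unset Strict Implicit.
Unset Printing Implicit Defensive.

Import Order.TTheory GRing.Theory Num.Theory.
Import numFieldNormedType.Exports.

Local Open Scope classical_set_scope.
Local Open Scope ring_scope.

(* The product measure on the product of the Borel sigma-algebras. *)
Definition borel_volume (R : realType)
    : set (measurableTypeR R * measurableTypeR R * measurableTypeR R)
      -> \bar R :=
  ((@lebesgue_measure R \x @lebesgue_measure R) \x @lebesgue_measure R)%E.

HB.instance Definition _ (R : realType) := Measure.on (@borel_volume R).

(* R^3 with the Lebesgue (completed) sigma-algebra, given as the Caratheodory
   measurable sets of the outer measure induced by [borel_volume]. *)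
Definition space3 (R : realType) : Type :=
  caratheodory_type (mu_ext (@borel_volume R)).

HB.instance Definition _ (R : realType) := Measurable.on (space3 R).

Definition volume (R : realType) : set (space3 R) -> \bar R :=
  @completed_measure_extension _ _ _ (@borel_volume R).

HB.instance Definition _ (R : realType) := Measure.on (@volume R).

(* The pair (k, m) stands for the interval [m 2^-k, (m+1) 2^-k). *)
Definition dyadic : Type := (int * int)%type.

HB.instance Definition _ := Choice.on dyadic.

Section Dyadic.
Variable R : realType.
Implicit Types P Q : dyadic.

Definition side Q : R := 2 ^ (- Q.1).

Definition interval Q : set R :=
  `[Q.2%:~R * side Q, (Q.2 + 1)%:~R * side Q[%classic.

(* [%/] on int is the floor division; see [interval_ancestor] and
   [ancestor_unique]. *)
Definition ancestor (k : nat) Q : dyadic :=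
  (Q.1 - k%:Z, (Q.2 %/ (2 ^+ k : int))%Z).

End Dyadic.

Arguments side R Q : clear implicits.
Arguments interval R Q : clear implicits.

Lemma side_gt0 (R : realType) Q : 0 < side R Q.
Proof. by rewrite /side exprz_gt0. Qed.

Lemma side_ancestor (R : realType) k Q :
  side R (ancestor k Q) = 2 ^+ k * side R Q.
Proof.
rewrite /side /= opprB addrC expfzDr ?pnatr_eq0// mulrC.
by rewrite -exprnP.
Qed.

Lemma left_endpoint (R : realType) Q : interval R Q (Q.2%:~R * side R Q).
Proof.
rewrite /interval /= in_itv /= lexx /= intrD mulrDl mul1r.
by rewrite ltrDl side_gt0.
Qed.

Lemma interval_ancestor (R : realType) k Q :
  interval R Q `<=` interval R (ancestor k Q).
Proof.
move=> x; rewrite /interval /= !in_itv /= side_ancestor => /andP[x1 x2].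
have s0 := side_gt0 R Q.
have d0 : (2 ^+ k : int) != 0 by rewrite expf_neq0.
have dp : (0 < 2 ^+ k :> int) by rewrite exprn_gt0.
have e2 : (2 ^+ k : R) = (2 ^+ k : int)%:~R by rewrite rmorphXn.
rewrite !mulrA e2 -!intrM; apply/andP; split.
  apply: le_trans x1; rewrite ler_pM2r// ler_int.
  exact: lez_floor.
apply: lt_le_trans x2 _; rewrite ler_pM2r// ler_int.
have := ltz_ceil Q.2 dp; lia.
Qed.

Lemma ancestor_unique (R : realType) k P Q :
  side R P = 2 ^+ k * side R Q -> interval R Q `<=` interval R P ->
  P = ancestor k Q.
Proof.
rewrite -side_ancestor => sPQ QP.
have /= := QP _ (left_endpoint R Q).
have /= := interval_ancestor k (left_endpoint R Q).
rewrite /interval /= !in_itv /= sPQ.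
have s0 := side_gt0 R (ancestor k Q).
have e1 : P.1 = (ancestor k Q).1.
  apply: oppr_inj; apply: (@ieexprIz R 2) => //.
  by rewrite gt_eqF // ltr1n.
move=> /andP[a1 a2] /andP[b1 b2].
have := le_lt_trans a1 b2; have := le_lt_trans b1 a2.
rewrite !ltr_pM2r// !ltr_int => c1 c2.
have e2 : P.2 = (ancestor k Q).2 by move: c1 c2 => /=; lia.
by move: e1 e2; case: P {sPQ QP b1 b2 c1 c2} => p1 p2 /= -> ->.
Qed.

Lemma interval_inj (R : realType) : injective (interval R).
Proof.
move=> P Q PQ.
wlog PleQ : P Q PQ / Q.1 <= P.1.
  move=> H; have [|/ltW] := leP Q.1 P.1; first exact: H.
  by move=> /H ->.
have [k kE] : exists k : nat, P.1 - Q.1 = k%:Z.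
  by exists `|P.1 - Q.1|%N; rewrite gez0_abs// subr_ge0.
have QA : Q = ancestor k P.
  apply: (@ancestor_unique R); last by rewrite PQ.
  by rewrite /side exprnP -expfzDr ?pnatr_eq0// -kE addrAC subrr sub0r.
case: k kE QA => [kE QA|k kE QA].
  by rewrite {1}QA /ancestor expr0 divz1 subr0; case: (P).
exfalso.
have sP := side_gt0 R P.
have sQ : side R Q = 2 ^+ k.+1 * side R P by rewrite {1}QA side_ancestor.
have k1 : 1 <= 2 ^+ k :> R by rewrite exprn_ege1// ler1n.
have h1 : side R Q >= 2 * side R P.
  by rewrite sQ exprS -mulrA ler_wpM2l// ler_peMl// ltW.
have l1 := left_endpoint R P; have l2 := left_endpoint R Q.
rewrite PQ in l1; rewrite -PQ in l2.
have : interval R Q (Q.2%:~R * side R Q + side R P).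
  rewrite /interval /= in_itv /= intrD mulrDl mul1r; apply/andP; split; lra.
rewrite -PQ /interval /= in_itv /=.
move: l1 l2; rewrite /interval /= !in_itv /= !intrD !mulrDl !mul1r.
by move=> _ /andP[b1 _] /andP[_]; rewrite ltrD2r ltNge b1.
Qed.

Definition rectangle : Type := (dyadic * dyadic * dyadic)%type.

HB.instance Definition _ := Choice.on rectangle.

Section SubZygmund.
Variable R : realType.
Implicit Types I J : rectangle.

Definition rect I : set (space3 R) :=
  interval R I.1.1 `*` interval R I.1.2 `*` interval R I.2.

Definition subZygmund : set rectangle :=
  [set I | side R I.2 <= side R I.1.1 * side R I.1.2].

Definition ancestor1 (k : nat) I : rectangle := (ancestor k I.1.1, I.1.2, I.2).

Definition ancestor2 (k : nat) I : rectangle := (I.1.1, ancestor k I.1.2, I.2).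

Definition maximal_function (f : space3 R -> R) (x : space3 R) : \bar R :=
  ereal_sup [set (volume (rect I))^-1 * \int[@volume R]_(y in rect I) `|f y|%:E
            | I in [set I | subZygmund I /\ rect I x]]%E.

Definition enlargement (Omega : set (space3 R)) : set (space3 R) :=
  [set x | ((2^-1)%:E < maximal_function \1_Omega x)%E].

(* [A `&` ubound A] has at most one element, the maximum of [A].  The default
   value 0 is never relevant for rectangles of the basis contained in a
   measurable set of finite measure: the depth sets below then contain 0, and
   they are bounded because the enlargement has finite measure. *)
Definition max_nat (A : set nat) : nat := xget 0%N (A `&` ubound A).

Definition depth1 I (Omega : set (space3 R)) : nat :=
  max_nat [set k | rect (ancestor1 k I) `<=` enlargement Omega].

Definition depth2 I (Omega : set (space3 R)) : nat :=
  max_nat [set k | rect (ancestor2 k I) `<=` enlargement Omega].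

(* Distinct codes give distinct sets, see [rect_inj]. *)
Definition incomparable (S : set rectangle) : Prop :=
  forall I J, S I -> S J -> rect I `<=` rect J -> I = J.

Definition unit_cube : set (space3 R) :=
  `[0 : R, 1[%classic `*` `[0 : R, 1[%classic `*` `[0 : R, 1[%classic.

End SubZygmund.

Arguments rect R I : clear implicits.
Arguments subZygmund R : clear implicits.
Arguments incomparable R S : clear implicits.
Arguments unit_cube R : clear implicits.

Lemma rect_inj (R : realType) : injective (rect R).
Proof.
have prodI (T U : Type) (A B : set T) (C D : set U) :
    A !=set0 -> C !=set0 -> A `*` C = B `*` D -> A `<=` B /\ C `<=` D.
  move=> [a Aa] [c Cc] E; split => [x Ax|x Cx].
    by have [] : (B `*` D) (x, c) by rewrite -E.
  by have [] : (B `*` D) (a, x) by rewrite -E.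
have ne Q : interval R Q !=set0 by eexists; exact: left_endpoint.
have neX P Q : interval R P `*` interval R Q !=set0.
  by have [p ?] := ne P; have [q ?] := ne Q; exists (p, q).
move=> [[P1 P2] P3] [[Q1 Q2] Q3]; rewrite /rect /= => E.
have [a1 a3] := prodI _ _ _ _ _ _ (neX _ _) (ne _) E.
have [b1 b3] := prodI _ _ _ _ _ _ (neX _ _) (ne _) (esym E).
have /seteqP E12 := conj a1 b1.
have [c1 c2] := prodI _ _ _ _ _ _ (ne _) (ne _) E12.
have [d1 d2] := prodI _ _ _ _ _ _ (ne _) (ne _) (esym E12).
congr (_, _, _); apply: (@interval_inj R); exact/seteqP.
Qed.

(* Main.v *)
(** A dyadic interval either lies in [0,1) or has at most half of its length in
    common with it, so the unit cube is its own enlargement, and a rectangle of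
    the cube with first two sides 2^-a and 2^-b has depths (a, b).  For every
    a + b <= N tile the cube by the rectangles of size
    2^-a x 2^-b x 2^-(2N - a - b).  They are sub-Zygmund exactly because
    a + b <= N, and each tiling contributes w(a, b).  The third side shrinks
    when one of the first two grows, so rectangles of different tilings are
    incomparable.  Letting N tend to infinity in the packing estimate for the
    unit cube bounds every finite sum of w by C. *)

Require Import Defs.
From mathcomp Require Import all_boot all_order all_algebra.
From mathcomp Require Import all_classical all_reals all_analysis.
From mathcomp Require Import zify.

Import Order.TTheory GRing.Theory Num.Theory.
Import numFieldNormedType.Exports.

Local Open Scope classical_set_scope.
Local Open Scope ring_scope.

(* The intervals of MathComp shadow the dyadic ones. *)
Local Notation interval := Defs.interval.

(** * Volumes of products of intervals *)

Lemma measurable_interval (R : realType) Q :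
  measurable (interval R Q : set (measurableTypeR R)).
Proof. exact: measurable_itv. Qed.

Lemma measurable_setX3 (R : realType) (A B C : set (measurableTypeR R)) :
  measurable A -> measurable B -> measurable C ->
  measurable (A `*` B `*` C : set (space3 R)).
Proof.
move=> mA mB mC; apply: caratheodory_measurable_mu_ext.
by apply: measurableX => //; exact: measurableX.
Qed.

(** On Borel product sets the completed measure agrees with [borel_volume], and the product formula
    then applies twice. *)
Lemma volume_setX3 (R : realType) (A B C : set (measurableTypeR R)) :
  measurable A -> measurable B -> measurable C ->
  volume (A `*` B `*` C : set (space3 R)) =
  (lebesgue_measure A * lebesgue_measure B * lebesgue_measure C)%E.
Proof.
move=> mA mB mC; have mAB := measurableX mA mB.
rewrite /volume /completed_measure_extension measurable_mu_extE.
  rewrite -(product_measure1E _ _ mA mB).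
  exact: (product_measure1E (lebesgue_measure \x lebesgue_measure)%E
    lebesgue_measure mAB mC).
exact: measurableX.
Qed.

Lemma lebesgue_measure_interval (R : realType) Q :
  lebesgue_measure (interval R Q) = (side R Q)%:E.
Proof.
rewrite /interval lebesgue_measure_itv/= lte_fin.
have s0 := side_gt0 R Q.
rewrite ltr_pM2r// ltr_int ltrDl ltr01 -EFinB -mulrBl -intrB.
by rewrite (addrC Q.2) addrK mul1r.
Qed.

Lemma volume_rect (R : realType) I :
  volume (rect R I) = (side R I.1.1 * side R I.1.2 * side R I.2)%:E.
Proof.
rewrite volume_setX3; try exact: measurable_interval.
by rewrite !lebesgue_measure_interval.
Qed.

Definition unit_dyadic : dyadic := (0, 0).

Lemma side_unit (R : realType) : side R unit_dyadic = 1.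
Proof. by rewrite /side oppr0 expr0z. Qed.

Lemma interval_unit (R : realType) : interval R unit_dyadic = `[0, 1[%classic.
Proof. by rewrite /interval side_unit !mulr1. Qed.

Lemma rect_unit (R : realType) :
  rect R (unit_dyadic, unit_dyadic, unit_dyadic) = unit_cube R.
Proof. by rewrite /rect /= interval_unit. Qed.

Lemma volume_unit_cube (R : realType) : volume (unit_cube R) = 1%E.
Proof. by rewrite -rect_unit volume_rect/= side_unit !mulr1. Qed.

(** * Intervals and rectangles against the unit interval and cube *)

Lemma side_le (R : realType) P Q :
  interval R P `<=` interval R Q -> side R P <= side R Q.
Proof.
move=> PQ; rewrite -lee_fin -!lebesgue_measure_interval.
by apply: le_measure => //; rewrite inE; exact: measurable_interval.
Qed.

Lemma level_le (R : realType) P Q :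
  interval R P `<=` interval R Q -> Q.1 <= P.1.
Proof.
by move=> /side_le; rewrite /side ler_eXz2l ?ltr1n// lerN2.
Qed.

(** Writing 1 as [2 ^+ k] sides turns comparisons of endpoints with 1 into comparisons of
    integers. *)
Lemma side_nat (R : realType) (k : nat) (m : int) :
  side R (k%:Z, m) * (2 ^+ k : int)%:~R = 1.
Proof. by rewrite /side/= -exprnN rmorphXn/= mulVf// expf_neq0. Qed.

Lemma interval_subset_unit (R : realType) (k : nat) (m : int) :
  interval R (k%:Z, m) `<=` `[0, 1[%classic <-> (0 <= m < 2 ^+ k).
Proof.
have s1 := side_nat R k m; have s0 := side_gt0 R (k%:Z, m).
split => [QU|/andP[m0 m1] x].
  have := QU _ (left_endpoint R _); rewrite /= in_itv/= pmulr_lge0// ler0z.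
  by rewrite -[X in _ < X]s1 [X in _ < X]mulrC ltr_pM2r// ltr_int.
rewrite /Defs.interval/= !in_itv/= => /andP[x0 x1]; apply/andP; split.
  by apply: le_trans x0; rewrite mulr_ge0 ?ler0z// ltW.
apply: lt_le_trans x1 _; rewrite -[leRHS]s1 [leRHS]mulrC ler_pM2r// ler_int.
by rewrite -ltzD1; lia.
Qed.

Lemma interval_meet_unit (R : realType) (Q : dyadic) :
  ~ interval R Q `<=` `[0, 1[%classic ->
  (lebesgue_measure (interval R Q `&` `[0%R, 1%R[%classic)
   <= (2^-1 * side R Q)%:E)%E.
Proof.
have s0 := side_gt0 R Q.
(* At a negative level the side is at least 2, so the whole of [0,1) has at most half that
   length. *)
case: Q s0 => -[k|k] m s0; last first.
  move=> _; apply: (@le_trans _ _ 1%E).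
    apply: (@le_trans _ _ (lebesgue_measure `[0%R, 1%R[%classic)).
      apply: le_measure; rewrite ?inE; last exact: subIsetr.
      - apply: measurableI; first exact: measurable_interval.
        exact: measurable_itv.
      - exact: measurable_itv.
    by rewrite -interval_unit lebesgue_measure_interval side_unit.
  rewrite lee_fin ler_pdivlMl// mulr1 /side/= NegzE opprK.
  by rewrite -exprnP -[leLHS]expr1 ler_eXn2l// ltr1n.
(* At a nonnegative level the two intervals are disjoint: a common point would give
   [0 <= m < 2 ^+ k], hence inclusion. *)
move=> H; rewrite [X in lebesgue_measure X](_ : _ = set0).
  by rewrite measure0 lee_fin mulr_ge0// ltW.
have s1 := side_nat R k m.
rewrite -subset0 => x []; rewrite /Defs.interval/= !in_itv/=.
move=> /andP[a1 a2] /andP[b1 b2]; apply: H.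
apply/interval_subset_unit; apply/andP; split.
  have := le_lt_trans b1 a2; rewrite pmulr_lgt0// ltr0z.
  by rewrite ltzD1.
have := le_lt_trans a1 b2.
by rewrite -[X in _ < X]s1 [X in _ < X]mulrC ltr_pM2r// ltr_int.
Qed.

Lemma setX_subset (T U : Type) (A B : set T) (C D : set U) :
  A !=set0 -> C !=set0 -> A `*` C `<=` B `*` D -> A `<=` B /\ C `<=` D.
Proof.
move=> [a Aa] [c Cc] ACBD; split => [x Ax|x Cx].
  by have [] := ACBD (x, c).
by have [] := ACBD (a, x).
Qed.

Lemma interval_neq0 (R : realType) Q : interval R Q !=set0.
Proof. by eexists; exact: left_endpoint. Qed.

Lemma rect_subset (R : realType) (I J : rectangle) :
  rect R I `<=` rect R J <->
  [/\ interval R I.1.1 `<=` interval R J.1.1,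
      interval R I.1.2 `<=` interval R J.1.2 &
      interval R I.2 `<=` interval R J.2].
Proof.
split => [|[IJ1 IJ2 IJ3]]; last by do 2! apply: setSX => //.
have n2 : interval R I.1.1 `*` interval R I.1.2 !=set0.
  have [x Ix] := interval_neq0 R I.1.1; have [y Iy] := interval_neq0 R I.1.2.
  by exists (x, y).
move=> /(setX_subset _ _ _ _ _ _ n2 (interval_neq0 _ _))[IJ12 IJ3].
have := setX_subset _ _ _ _ _ _ (interval_neq0 _ _) (interval_neq0 _ _) IJ12.
by move=> [].
Qed.

(** Some side interval is not contained in [0,1). That factor of the intersection is at most half
    its side, and the other two are at most their full sides. *)
Lemma rect_meet_unit_cube (R : realType) (I : rectangle) :
  ~ rect R I `<=` unit_cube R ->
  (volume (rect R I `&` unit_cube R) <= (2^-1)%:E * volume (rect R I))%E.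
Proof.
rewrite -rect_unit rect_subset/= interval_unit volume_rect => H.
rewrite /rect/= interval_unit -!setXI volume_setX3; try
  by apply: measurableI; [exact: measurable_interval|exact: measurable_itv].
set U : set R := `[0, 1[%classic.
have le_side Q : (lebesgue_measure (interval R Q `&` U) <= (side R Q)%:E)%E.
  rewrite -lebesgue_measure_interval; apply: le_measure; rewrite ?inE.
  - by apply: measurableI; [exact: measurable_interval|exact: measurable_itv].
  - exact: measurable_interval.
  - exact: subIsetl.
have le3 (x y z : \bar R) (a b c : R) : (0 <= x -> 0 <= y -> 0 <= z ->
    x <= a%:E -> y <= b%:E -> z <= c%:E -> x * y * z <= (a * b * c)%:E)%E.
  move=> x0 y0 z0 xa yb zc; rewrite !EFinM.
  by apply: lee_pmul => //; [exact: mule_ge0|exact: lee_pmul].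
have [H1|H1] := pselect (interval R I.1.1 `<=` U); last first.
  rewrite -EFinM !mulrA; apply: le3 => //; exact: interval_meet_unit.
have [H2|H2] := pselect (interval R I.1.2 `<=` U); last first.
  rewrite -EFinM -mulrA mulrCA !mulrA -(mulrA (side R I.1.1)); apply: le3 => //.
  exact: interval_meet_unit.
have [H3|H3] := pselect (interval R I.2 `<=` U); first by case: H.
by rewrite -EFinM mulrCA; apply: le3 => //; exact: interval_meet_unit.
Qed.

(** * The enlargement of the cube and the depths *)

Lemma enlargement_unit_cube (R : realType) :
  enlargement (unit_cube R) = unit_cube R.
Proof.
pose U : rectangle := (unit_dyadic, unit_dyadic, unit_dyadic).
have mr I : measurable (rect R I) by apply: measurable_setX3;
  exact: measurable_interval.
have mU : measurable (unit_cube R) by rewrite -rect_unit.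
have intE I : (\int[@volume R]_(y in rect R I) `|\1_(unit_cube R) y|%:E =
    volume (rect R I `&` unit_cube R))%E.
  under eq_integral do rewrite ger0_norm//.
  by rewrite integral_indic// setIC.
apply/seteqP; split => x; rewrite /enlargement/=.
  (* A rectangle through [x] with average above 1/2 must lie in the cube, since otherwise its
     average is at most 1/2. *)
  move=> /ereal_sup_gt[_ [I [sI Ix] <-]]; rewrite intE.
  have [IU _|/rect_meet_unit_cube IU] :=
    pselect (rect R I `<=` unit_cube R); first exact: IU.
  have v0 : 0 < side R I.1.1 * side R I.1.2 * side R I.2.
    by rewrite !mulr_gt0// side_gt0.
  move: IU; rewrite volume_rect inver gt_eqF// lte_pdivlMl// => IU.
  by move=> /lt_le_trans /(_ IU); rewrite muleC ltxx.
(* Conversely, the cube is itself a rectangle of the basis, with average 1. *)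
move=> Ux; apply: (@lt_le_trans _ _ 1%E).
  by rewrite lte_fin invf_lt1// ltr1n.
apply: ereal_sup_ubound; exists U.
  split; last by rewrite rect_unit.
  by rewrite /subZygmund/= side_unit mulr1.
by rewrite intE rect_unit setIid volume_unit_cube inver oner_eq0 invr1 mule1.
Qed.

Lemma max_nat_le (a : nat) : max_nat [set k | (k <= a)%N] = a.
Proof.
rewrite /max_nat; case: xgetP => [b _ [/= ba ub]|/(_ a)[]].
  by apply/eqP; rewrite eqn_leq ba; exact: (ub a (leqnn a)).
by split => //= k.
Qed.

(** Inclusion forces the level [a - k] to be nonnegative. Conversely, for [k <= a], the quotient of
    [m] by [2 ^+ k] stays in the range from 0 to [2 ^+ (a - k)]. *)
Lemma ancestor_subset_unit (R : realType) (a k : nat) (m : int) :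
  0 <= m < 2 ^+ a ->
  interval R (ancestor k (a%:Z, m)) `<=` `[0, 1[%classic <-> (k <= a)%N.
Proof.
move=> /andP[m0 ma]; split => [|ka].
  by rewrite -interval_unit => /level_le/=; rewrite subr_ge0.
rewrite /ancestor/= subzn//; apply/interval_subset_unit/andP; split.
  by rewrite divz_ge0// exprn_gt0.
by rewrite ltz_divLR ?exprn_gt0// -exprD subnK.
Qed.

Lemma depths_unit_cube (R : realType) (a b : nat) (i j : int) (K : dyadic) :
  rect R ((a%:Z, i), (b%:Z, j), K) `<=` unit_cube R ->
  depth1 ((a%:Z, i), (b%:Z, j), K) (unit_cube R) = a /\
  depth2 ((a%:Z, i), (b%:Z, j), K) (unit_cube R) = b.
Proof.
rewrite -rect_unit rect_subset/= rect_unit interval_unit => -[Ia Jb Kc].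
have ia := (interval_subset_unit R a i).1 Ia.
have jb := (interval_subset_unit R b j).1 Jb.
rewrite /depth1 /depth2 enlargement_unit_cube.
split; rewrite -[RHS]max_nat_le; congr max_nat; apply/seteqP; split => k/=;
  rewrite -rect_unit rect_subset/= interval_unit.
- by move=> [/(ancestor_subset_unit R _ _ _ ia)].
- by move=> ka; split => //; exact/ancestor_subset_unit.
- by move=> [_ /(ancestor_subset_unit R _ _ _ jb)].
- by move=> kb; split => //; exact/ancestor_subset_unit.
Qed.

(** * The tilings and their union *)

Definition triangle (N : nat) : set (nat * nat) := [set p | (p.1 + p.2 <= N)%N].

(* All tilings have 4 ^ N members; the binary digits of t < 4 ^ N encode the
   three positions. *)
Definition tile (N : nat) (q : nat * nat * nat) : rectangle :=
  let: (a, b, t) := q in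
  ((a%:Z, (t %% 2 ^ a)%N%:Z), (b%:Z, (t %/ 2 ^ a %% 2 ^ b)%N%:Z),
   ((N + N - (a + b))%N%:Z, (t %/ 2 ^ (a + b))%N%:Z)).

Definition tile_index (N : nat) : set (nat * nat * nat) :=
  triangle N `*` `I_(2 ^ (N + N)).

Definition tiling (N : nat) : set rectangle := tile N @` tile_index N.

Lemma finite_triangle N : finite_set (triangle N).
Proof.
apply: (@sub_finite_set _ _ (`I_N.+1 `*` `I_N.+1)).
  by move=> [a b]; rewrite /triangle/= !ltnS => abN; split; lia.
by apply: finite_setX; exact: finite_II.
Qed.

Lemma finite_tile_index N : finite_set (tile_index N).
Proof. by apply: finite_setX; [exact: finite_triangle|exact: finite_II]. Qed.

Lemma finite_tiling N : finite_set (tiling N).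
Proof. exact/finite_image/finite_tile_index. Qed.

(** The first two levels return [a] and [b], and the three positions are successive remainders and
    the final quotient of [t], which determine [t]. *)
Lemma tile_inj N : {in tile_index N &, injective (tile N)}.
Proof.
move=> [[a b] t] [[a' b'] t'] _ _ [<- t1 <- t2 _ t3].
congr (_, _, _); rewrite (divn_eq t (2 ^ a)) (divn_eq t' (2 ^ a)) t1.
rewrite (divn_eq (t %/ 2 ^ a) (2 ^ b)) (divn_eq (t' %/ 2 ^ a) (2 ^ b)) t2.
by rewrite -!divnMA -expnD t3.
Qed.

Lemma tiling_subset (R : realType) N I :
  tiling N I -> rect R I `<=` unit_cube R.
Proof.
move=> [[[a b] t] [/= abN tN] <-]; rewrite -rect_unit; apply/rect_subset => /=.
have lt2 k n : (k < 2 ^ n)%N -> 0 <= k%:Z < 2 ^+ n.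
  by move=> kn; rewrite le0z_nat/= -natrX natz ltz_nat.
rewrite interval_unit; split; apply/interval_subset_unit/lt2.
- by rewrite ltn_mod expn_gt0.
- by rewrite ltn_mod expn_gt0.
- rewrite /triangle/= in abN; rewrite ltn_divLR ?expn_gt0// -expnD subnK//; lia.
Qed.

Lemma side_nat_dyadic (R : realType) (k : nat) (m : int) :
  side R (k%:Z, m) = 2^-1 ^+ k.
Proof. by rewrite /side/= -exprnN exprVn. Qed.

Lemma tiling_subZygmund (R : realType) N : tiling N `<=` subZygmund R.
Proof.
move=> _ [[[a b] t] [/= abN tN] <-]; rewrite /subZygmund/= !side_nat_dyadic.
rewrite /triangle/= in abN.
rewrite -exprD ler_wiXn2l// ?invr_ge0// ?invf_le1 ?ler1n//; lia.
Qed.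

Lemma volume_tile (R : realType) N q : tile_index N q ->
  volume (rect R (tile N q)) = ((2^-1 ^+ (N + N))%:E : \bar R).
Proof.
case: q => -[a b] t [/= abN tN]; rewrite volume_rect/= !side_nat_dyadic.
rewrite -!exprD subnKC//; rewrite /triangle/= in abN; lia.
Qed.

Lemma same_level_eq (R : realType) (P Q : dyadic) :
  P.1 = Q.1 -> interval R P `<=` interval R Q -> P = Q.
Proof.
move=> PQ1 PQ; have <- : ancestor 0 P = P.
  by case: (P) => k m; rewrite /ancestor/= expr0 divz1 subr0.
apply/esym/(@ancestor_unique R) => //.
by rewrite expr0 mul1r /side PQ1.
Qed.

Lemma tiling_incomparable (R : realType) N : incomparable R (tiling N).
Proof.
move=> _ _ [[[a b] t] [/= abN tN] <-] [[[a' b'] t'] [/= abN' tN'] <-].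
rewrite /triangle/= in abN abN'.
move=> /rect_subset/=[I1 I2 I3].
have /= := (level_le R _ _ I1, level_le R _ _ I2, level_le R _ _ I3).
move=> [[l1 l2] l3].
(* The first two inclusions give [a' <= a] and [b' <= b]. The third gives [a + b <= a' + b'], the
   truncated subtractions being exact because both sums are at most [N]. *)
have [aa' bb'] : a = a' /\ b = b' by split; lia.
move: aa' bb' I1 I2 I3 => <- <- I1 I2 I3.
by rewrite (same_level_eq R _ _ _ I1)// (same_level_eq R _ _ _ I2)//
  (same_level_eq R _ _ _ I3).
Qed.

(** * Weighted sums over the tilings *)

Lemma tiling_sum (R : realType) N (w : nat -> nat -> R) :
  (\sum_(I \in tiling N)
     (w (depth1 I (unit_cube R)) (depth2 I (unit_cube R)))%:E
     * volume (rect R I)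
   = (\sum_(p \in triangle N) w p.1 p.2)%:E)%E.
Proof.
rewrite /tiling fsbig_image; last exact: tile_inj.
rewrite (eq_fsbigr (fun q => (w q.1.1 q.1.2 * 2^-1 ^+ (N + N))%:E)); last first.
  move=> q /set_mem Pq; rewrite volume_tile// EFinM.
  have := tiling_subset R N _ (imageP _ Pq).
  by case: q Pq => -[a b] t Pq /depths_unit_cube[-> ->].
rewrite fsumEFin; last exact: finite_tile_index.
rewrite -(pair_fsbig _ (fun p _ => w p.1 p.2 * 2^-1 ^+ (N + N)))//=;
  last exact: finite_triangle.
congr (_%:E); apply: eq_fsbigr => p _.
(* For fixed [p] the [2 ^ (N + N)] tiles of volume [2^-1 ^+ (N + N)] have total volume 1. *)
rewrite -fsbig_ord sumr_const card_ord -[LHS]mulr_natr natrX -mulrA -exprMn.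
by rewrite mulVf// expr1n mulr1.
Qed.

Lemma triangle_sum (R : realType) N (w : nat -> nat -> R) :
  \sum_(p \in triangle N) w p.1 p.2 =
  \sum_(a < N.+1) \sum_(b < N.+1 | (a + b <= N)%N) w a b.
Proof.
pose v a b := if (a + b <= N)%N then w a b else 0.
(* Extended by zero off the triangle, the double sum runs over a full square and becomes a sum over
   pairs. *)
under [RHS]eq_bigr do rewrite big_mkcond (fsbig_ord _ _ (v _)).
rewrite (fsbig_ord _ _ (fun a => \sum_(b \in `I_N.+1) v a b)).
rewrite pair_fsbig; [|exact: finite_II|exact: finite_II].
rewrite -(fsbig_widen (triangle N)).
- by apply: eq_fsbigr => p /set_mem; rewrite /triangle/= /v => ->.
- by move=> [a b]; rewrite /triangle/= !ltnS => abN; split; lia.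
- by move=> [a b] [_]; rewrite /triangle/= /v; case: ifP.
Qed.

Theorem proposition7p1 (R : realType) :
  (forall N : nat,
     exists S : set rectangle,
       [/\ finite_set S,
           incomparable R S,
           S `<=` subZygmund R,
           (forall I, S I -> rect R I `<=` unit_cube R) &
           forall w : nat -> nat -> R, (forall a b, 0 <= w a b) ->
             ((volume (unit_cube R))^-1 *
               \sum_(I \in S)
                 (w (depth1 I (unit_cube R)) (depth2 I (unit_cube R)))%:E
                 * volume (rect R I)
             = (\sum_(a < N.+1) \sum_(b < N.+1 | (a + b <= N)%N) w a b)%:E)%E])
  /\
  (forall w : nat -> nat -> R, (forall a b, 0 <= w a b) ->
     (exists C : R,
        forall Omega : set (space3 R),
          measurable Omega -> (volume Omega < +oo)%E ->
          forall U : set rectangle,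
            incomparable R U -> U `<=` subZygmund R ->
            (forall I, U I -> rect R I `<=` Omega) ->
            (\esum_(I in U) ((w (depth1 I Omega) (depth2 I Omega))%:E
                             * volume (rect R I))
             <= C%:E * volume Omega)%E) ->
     (\esum_(p in [set: nat * nat]) (w p.1 p.2)%:E < +oo)%E).
Proof.
split=> [N|w w0 [C HC]].
  exists (tiling N); split.
  - exact: finite_tiling.
  - exact: tiling_incomparable.
  - exact: tiling_subZygmund.
  - by move=> I; exact: tiling_subset.
  move=> w _; rewrite volume_unit_cube inver oner_eq0 invr1 mul1e tiling_sum.
  by rewrite triangle_sum.
have w0E p : (0 <= (w p.1 p.2)%:E)%E by rewrite lee_fin.
have triangle_le N : (\sum_(p \in triangle N) (w p.1 p.2)%:E <= C%:E)%E.
  rewrite fsumEFin; last exact: finite_triangle.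
  (* The triangle sum is recast as the left side of the packing estimate for the family [tiling N]
     in the unit cube. *)
  rewrite -tiling_sum -esum_fset; [|exact: finite_tiling|]; last first.
    by move=> I _; rewrite mule_ge0// lee_fin.
  apply: le_trans (HC _ _ _ _ _ _ _) _.
  - by rewrite -rect_unit; apply: measurable_setX3; exact: measurable_interval.
  - by rewrite volume_unit_cube ltry.
  - exact: tiling_incomparable.
  - exact: tiling_subZygmund.
  - by move=> I; exact: tiling_subset.
  - by rewrite volume_unit_cube mule1.
apply: (@le_lt_trans _ _ C%:E); last exact: ltry.
(* The sum over all pairs is the supremum of its finite subsums, so it suffices to place each finite
   [F] in a triangle. *)
apply: ge_ereal_sup => _ [F [finF _] <-].
have [N FN] : exists N, F `<=` triangle N.
  have [s ->] := (finite_seqP _).1 finF.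
  (* The total of all coordinates in [F] bounds the coordinate sum of each of its members. *)
  exists (\sum_(p <- s) (p.1 + p.2))%N => p /= ps.
  by rewrite /triangle/= (big_rem p ps)/= leq_addr.
apply: le_trans (triangle_le N); apply: lee_fsum_nneg_subset => //.
- exact: finite_triangle.
- exact/subsetP.
Qed.
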